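(* Let $a,b$ be relatively prime integers such that the Lucas sequences below are non-degenerate, and suppose $a>0$ and $\Delta=a^2+4b>0$. Then for each positive integer $n$ and each prime $p\geq 3$, $$\tau(U_nU_{n+p}U_{n+2p})=\begin{cases} n(n+p)(n+2p), & p\nmid n,\ 2\nmid n,\\[2pt] \dfrac{n(n+p)(n+2p)}{2}\cdot\dfrac{a}{\gcd(a,n+p)}, & p\nmid n,\ 2\mid n,\\[2pt] \dfrac{n(n+p)(n+2p)}{p^2}U_p^2, & p\mid n,\ 2\nmid n,\\[2pt] \dfrac{n(n+p)(n+2p)}{2p^2}\cdot\dfrac{U_p^2V_p}{\gcd(V_p,(n+p)/p)}, & p\mid n,\ 2\mid n.\end{cases}$$
   Context: For relatively prime integers $a,b$, the first and second Lucas sequences are defined by $U_0=0$, $U_1=1$, $U_{n+2}=aU_{n+1}+bU_n$ and $V_0=2$, $V_1=a$, $V_{n+2}=aV_{n+1}+bV_n$ ($n\ge 0$). Non-degenerate means $b\neq 0$ and $\alpha/\beta$ is not a root of unity, where $\alpha,\beta$ are the roots of $x^2-ax-b=0$. For a positive integer $k$ with $\gcd(k,b)=1$, $\tau(k)$ (the order of appearance) is the smallest positive integer $t$ with $k\mid U_t$. *)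

(* Defs.v *)
From HB Require Import structures.
From mathcomp Require Import all_boot all_order all_algebra algC.
From mathcomp Require Import boolp.

Set Implicit Arguments.
Unset Strict Implicit.
Unset Printing Implicit Defensive.

Import Order.TTheory GRing.Theory Num.Theory.

Local Open Scope ring_scope.

Fixpoint lucasU (a b : int) (n : nat) {struct n} : int :=
  match n with
  | 0 => 0
  | m.+1 => match m with
            | 0 => 1
            | k.+1 => a * lucasU a b m + b * lucasU a b k
            end
  end.

Fixpoint lucasV (a b : int) (n : nat) {struct n} : int :=
  match n with
  | 0 => 2
  | m.+1 => match m with
            | 0 => a
            | k.+1 => a * lucasV a b m + b * lucasV a b k
            end
  end.

(* alpha and beta are the roots of x^2 - a x - b, counted with multiplicity;
   the factorization determines them up to order. *)
Definition lucas_nondegenerate (a b : int) : Prop :=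
  b != 0 /\
  forall alpha beta : algC,
    'X^2 - (a%:~R)%:P * 'X - (b%:~R)%:P
      = ('X - alpha%:P) * ('X - beta%:P) ->
    forall m : nat, (0 < m)%N -> (alpha / beta) ^+ m != 1.

(* Order of appearance of k in the sequence U.  The junk value 0 is taken only
   when k divides no U_t with t > 0; this does not occur for k > 0 with
   gcd(k, b) = 1. *)
Definition tau (a b k : int) : nat :=
  match pselect (exists t : nat, (0 < t)%N && (k %| lucasU a b t)%Z) with
  | left ex_t => ex_minn ex_t
  | right _ => 0%N
  end.

(* Main.v *)
Require Import Defs.
From mathcomp Require Import all_boot all_order all_algebra.
From mathcomp Require Import boolp zify ring.
Set Implicit Arguments.
Unset Strict Implicit.
Import Order.TTheory GRing.Theory Num.Theory.
Local Open Scope ring_scope.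

(* Write L for the least common multiple of the three indices; if the product
   divides U_t then so does each factor, hence L divides t = L s. For a prime q
   dividing U_m, with 4 | U_m if q = 2, one has v_q(U_(mk)) = v_q(U_m) + v_q(k):
   U_(mk) / U_m is the k-th term of the Lucas sequence with parameters V_m and
   -(-b)^m, whose discriminant is divisible by U_m^2, so that it is k c^(k-1) to
   the required precision. Comparing v_q of both sides prime by prime gives the
   exact condition on s. The four cases are two: with (d, e) = (1, p) or (p, 1)
   the indices are d x, d (x + e), d (x + 2 e) with x coprime to e, and only the
   parity of x matters. *)

(** * Two-step induction, prime divisors and valuations of integers *)

Lemma nat_ind2 (P : nat -> Prop) :
  P 0%N -> P 1%N -> (forall n, P n -> P n.+1 -> P n.+2) -> forall n, P n.
Proof.
move=> P0 P1 PS n; suff [] : P n /\ P n.+1 by [].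
by elim: n => [|n [Pn PSn]]; split=> //; apply: PS.
Qed.

Lemma Euclid_dvdzM (q : nat) (x y : int) : prime q ->
  (q %| x * y)%Z = (q %| x)%Z || (q %| y)%Z.
Proof. by move=> q_pr; rewrite !dvdzE abszM Euclid_dvdM. Qed.

Lemma Euclid_dvdzX (q n : nat) (x : int) : prime q ->
  (q %| x ^+ n)%Z -> (q %| x)%Z.
Proof.
move=> q_pr; elim: n => [|n IHn]; first by rewrite expr0 !dvdzE Euclid_dvd1.
by rewrite exprS Euclid_dvdzM// => /orP[].
Qed.

Lemma prime_coprimez (q : nat) (x : int) : prime q ->
  coprimez q x = ~~ (q %| x)%Z.
Proof. by move=> q_pr; rewrite coprimezE dvdzE prime_coprime. Qed.

Lemma lognzM (q : nat) (x y : int) : x != 0 -> y != 0 ->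
  logn q `|x * y| = (logn q `|x| + logn q `|y|)%N.
Proof. by move=> x0 y0; rewrite abszM lognM// absz_gt0. Qed.

Lemma lognz_gt0 (q : nat) (x : int) : prime q -> x != 0 ->
  (0 < logn q `|x|)%N = (q %| x)%Z.
Proof.
by move=> q_pr x0; rewrite logn_gt0 mem_primes q_pr absz_gt0 x0 dvdzE.
Qed.

Lemma lognz_ndvd (q : nat) (x : int) : prime q -> x != 0 ->
  ~~ (q %| x)%Z -> logn q `|x| = 0%N.
Proof. by move=> q_pr x0; rewrite -lognz_gt0// -eqn0Ngt => /eqP. Qed.

Lemma dvdn_logP (m n : nat) : (0 < m)%N -> (0 < n)%N ->
  (forall q, prime q -> (logn q m <= logn q n)%N) <-> (m %| n)%N.
Proof.
move=> m0 n0; split=> [le_log|mn q _]; last exact: dvdn_leq_log.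
apply/dvdn_partP => // q; rewrite mem_primes => /and3P[q_pr _ _].
by rewrite p_part pfactor_dvdn// le_log.
Qed.

(** * Identities for the two Lucas sequences *)

Lemma lucasUSS (a b : int) n :
  lucasU a b n.+2 = a * lucasU a b n.+1 + b * lucasU a b n.
Proof. by []. Qed.

Section Lucas.
Variables a b : int.
Local Notation U := (lucasU a b).
Local Notation V := (lucasV a b).

Lemma lucasVSS n : V n.+2 = a * V n.+1 + b * V n.
Proof. by []. Qed.

Lemma lucasU_add m n : U (m + n).+1 = U m.+1 * U n.+1 + b * U m * U n.
Proof.
elim/nat_ind2: n => [||n IHn IHn1].
- by rewrite addn0 /=; ring.
- by rewrite addn1 !lucasUSS /=; ring.
- by move: IHn1; rewrite !addnS => IHn1; rewrite lucasUSS IHn IHn1 !lucasUSS; ring.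
Qed.

Lemma lucasV_U n : V n = 2 * U n.+1 - a * U n.
Proof.
elim/nat_ind2: n => [||n IHn IHn1]; [by rewrite /=; ring..|].
by rewrite lucasVSS IHn IHn1 !lucasUSS; ring.
Qed.

(** The left side is the product of U_(n+1) - alpha U_n = beta^n and U_(n+1) - beta U_n = alpha^n,
    and alpha beta = -b. *)
Lemma lucasU_norm n :
  U n.+1 ^+ 2 - a * U n * U n.+1 - b * U n ^+ 2 = (- b) ^+ n.
Proof.
elim: n => [|n IHn]; first by rewrite /=; ring.
by rewrite [RHS]exprS -IHn lucasUSS; ring.
Qed.

Lemma lucasV_norm n :
  V n ^+ 2 = (a ^+ 2 + 4 * b) * U n ^+ 2 + 4 * (- b) ^+ n.
Proof. by rewrite lucasV_U -lucasU_norm; ring. Qed.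

Lemma lucasU_double m : U (m + m) = U m * V m.
Proof.
case: m => [|m]; first by rewrite mul0r.
by rewrite addSn addnS -addnS lucasU_add lucasV_U !lucasUSS; ring.
Qed.

(** The recurrence for steps of length m: alpha^m and beta^m have sum V_m and product (-b)^m. *)
Lemma lucasU_shift2 m n :
  U (m + m + n) = V m * U (m + n) - (- b) ^+ m * U n.
Proof.
elim/nat_ind2: n => [||n IHn IHn1].
- by rewrite !addn0 lucasU_double; ring.
- by rewrite !addn1 lucasU_add lucasV_U -lucasU_norm /=; ring.
- by move: IHn1; rewrite !addnS => IHn1; rewrite !lucasUSS IHn IHn1; ring.
Qed.

(* With alpha, beta the roots of the sequence (a, b), those of the sequence
   (V_m, - (-b)^m) are alpha^m and beta^m. *)
Lemma lucasU_mul m k :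
  U (m * k) = U m * lucasU (V m) (- (- b) ^+ m) k.
Proof.
elim/nat_ind2: k => [||k IHk IHk1].
- by rewrite muln0 /=; ring.
- by rewrite muln1 /=; ring.
rewrite !mulnS addnA lucasU_shift2 -mulnS IHk IHk1 lucasUSS; ring.
Qed.

(* The characteristic polynomial is (X - c)^2 modulo M. *)
Lemma lucasU_mod_double_root (M c : int) k :
  (M %| a - 2 * c)%Z -> (M %| b + c ^+ 2)%Z ->
  (M %| U k.+1 - k.+1%:Z * c ^+ k)%Z.
Proof.
case/dvdzP=> x /eqP; rewrite subr_eq => /eqP aE.
case/dvdzP=> y /eqP; rewrite -subr_eq0 => /eqP bE.
elim/nat_ind2: k => [||k IHk IHk1].
- by rewrite expr0 /= subrr dvdz0.
- by apply/dvdzP; exists x; rewrite /= aE expr1; ring.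
case/dvdzP: IHk => u /eqP; rewrite subr_eq => /eqP uE.
case/dvdzP: IHk1 => v /eqP; rewrite subr_eq => /eqP vE.
(* The first two summands carry the errors of the two preceding terms, the last two those of a = 2 c
   + x M and b = - c^2 + y M. The main terms agree because 2 (k + 2) - (k + 1) = k + 3. *)
apply/dvdzP; exists (a * v + b * u + x * k.+2%:Z * c ^+ k.+1
  + y * k.+1%:Z * c ^+ k).
rewrite lucasUSS uE vE.
have -> : b = y * M - c ^+ 2 by apply/eqP; rewrite -subr_eq0 -bE; apply/eqP; ring.
by rewrite aE !intS !exprS; ring.
Qed.

End Lucas.

(** * Divisibility properties for coprime parameters *)

Section LucasCoprime.
Variables a b : int.
Hypothesis cop_ab : coprimez a b.
Local Notation U := (lucasU a b).
Local Notation V := (lucasV a b).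

Lemma coprime_lucasU_b n : coprimez (U n.+1) b.
Proof.
elim: n => [|n IHn]; first by rewrite coprimezE coprime1n.
rewrite coprimez_sym /coprimez lucasUSS addrC [b * _]mulrC gcdzMDl.
by rewrite -/(coprimez _ _) coprimezMr coprimez_sym cop_ab coprimez_sym.
Qed.

Lemma coprime_lucasUS n : coprimez (U n) (U n.+1).
Proof.
elim: n => [|n IHn]; first by rewrite coprimezE coprimen1.
by rewrite /coprimez lucasUSS gcdzMDl -/(coprimez _ _) coprimezMr
  coprime_lucasU_b coprimez_sym.
Qed.

(** In the addition formula only U_(m+1) U_n survives modulo k, and U_(m+1) is a unit there because
    consecutive terms are coprime. *)
Lemma dvdz_lucasUD (k : int) m n : (k %| U m)%Z ->
  (k %| U (m + n))%Z = (k %| U n)%Z.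
Proof.
move=> km; case: n => [|n]; first by rewrite addn0 km dvdz0.
rewrite addnS lucasU_add rpredDr; last by rewrite dvdz_mulr// dvdz_mull.
have cop : coprimez k (U m.+1).
  by case/dvdzP: km (coprime_lucasUS m) => x ->; rewrite coprimezMl => /andP[].
by rewrite Gauss_dvdzr.
Qed.

Lemma dvdz_lucasU_mul m k : (U m %| U (m * k))%Z.
Proof. by rewrite lucasU_mul dvdz_mulr. Qed.

Lemma dvdz_lucasU m n : (m %| n)%N -> (U m %| U n)%Z.
Proof. by case/dvdnP=> k ->; rewrite mulnC dvdz_lucasU_mul. Qed.

(** Euclid's algorithm on the indices: a multiple of m can be removed from n without affecting
    divisibility by k. *)
Lemma dvdz_lucasU_gcd (k : int) m n :
  (k %| U m)%Z -> (k %| U n)%Z -> (k %| U (gcdn m n))%Z.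
Proof.
elim/ltn_ind: m n => -[|m] IHm n km kn; first by rewrite gcd0n.
have kr : (k %| U (n %% m.+1))%Z.
  have kq : (k %| U (n %/ m.+1 * m.+1))%Z.
    by rewrite mulnC; apply: dvdz_trans km (dvdz_lucasU_mul _ _).
  by rewrite -(dvdz_lucasUD _ kq) -divn_eq.
by rewrite -gcdn_modr gcdnC IHm// ltn_mod.
Qed.

Lemma prime_ndvd_lucasUS (q : nat) m : prime q -> (q %| U m)%Z ->
  ~~ (q %| U m.+1)%Z.
Proof.
move=> q_pr qm; rewrite -prime_coprimez//.
by case/dvdzP: qm (coprime_lucasUS m) => x ->; rewrite coprimezMl => /andP[].
Qed.

Lemma lucasU_even_V m : (2 %| U m)%Z -> (2 %| V m)%Z.
Proof. by rewrite lucasV_U => um; rewrite rpredB ?(dvdz_mull _ um) ?dvdz_mulr. Qed.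

(** Modulo q, V_m is 2 U_(m+1), a product of two units. *)
Lemma prime_ndvd_lucasV (q : nat) m : prime q -> q != 2%N -> (q %| U m)%Z ->
  ~~ (q %| V m)%Z.
Proof.
move=> q_pr q2 qm; rewrite lucasV_U rpredBr ?(dvdz_mull _ qm)// Euclid_dvdzM//.
rewrite negb_or prime_ndvd_lucasUS// andbT dvdzE /=.
by rewrite dvdn_prime2.
Qed.

(** Modulo q the sequence with parameters (V_m, - (-b)^m) has the double root U_(m+1), a unit, so
    its k-th term is k U_(m+1)^(k-1). Precision q is enough here, so q = 2 needs no separate
    treatment. *)
Lemma lucasU_ratio_ndvd (q m k : nat) : prime q -> (q %| U m)%Z ->
  ~~ (q %| k)%N -> ~~ (q %| lucasU (V m) (- (- b) ^+ m) k)%Z.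
Proof.
move=> q_pr qm; case: k => // k qk.
have q_c := prime_ndvd_lucasUS q_pr qm.
have /dvdzP[u uE] := qm.
have A : (q %| V m - 2 * U m.+1)%Z.
  by rewrite lucasV_U addrC addKr rpredN dvdz_mull.
have B : (q %| - (- b) ^+ m + U m.+1 ^+ 2)%Z.
  apply/dvdzP; exists (a * u * U m.+1 + b * u * U m).
  by rewrite -(lucasU_norm a) uE; ring.
have := lucasU_mod_double_root k A B; set W := lucasU _ _ _ => qW.
apply: contra qk => /(rpredB qW); rewrite addrAC subrr sub0r rpredN.
rewrite Euclid_dvdzM// => /orP[|/(Euclid_dvdzX q_pr)]; last by rewrite (negPf q_c).
by rewrite dvdzE.
Qed.

(* The witness is V_m / 2, read modulo q^2 as V_m (q^2 + 1) / 2 when q is odd. *)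
Lemma double_root_mod_square (q m : nat) : prime q -> (q %| U m)%Z ->
  (q = 2%N -> (4 %| U m)%Z) ->
  exists c : int, [/\ ~~ (q %| c)%Z, ((q ^ 2)%N %| V m - 2 * c)%Z
    & ((q ^ 2)%N %| - (- b) ^+ m + c ^+ 2)%Z].
Proof.
move=> q_pr qm q4; have q_c := prime_ndvd_lucasUS q_pr qm.
have [q2|q2] := eqVneq q 2%N.
  (* With U_m = 4 u this is exactly V_m / 2 = U_(m+1) - a U_m / 2. *)
  subst q; case/dvdzP: (q4 erefl) => u uE; exists (U m.+1 - 2 * a * u); split.
  - by rewrite rpredBr// -mulrA dvdz_mulr.
  - by apply/dvdzP; exists 0; rewrite lucasV_U uE; ring.
  - apply/dvdzP; exists ((a ^+ 2 + 4 * b) * u ^+ 2).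
    by rewrite -(lucasU_norm a) uE -[(2 ^ 2)%N%:Z]/(4 : int); ring.
have q_odd : odd q by case: (even_prime q_pr) q2 => [->|].
have [h hE] : exists h : nat, (q ^ 2 = h.*2.+1)%N.
  by exists (q ^ 2)./2; rewrite -[LHS]odd_double_half oddX q_odd orbT.
case/dvdzP: qm => u uE; exists (V m * h.+1%:Z).
have hZ : (q ^ 2)%N%:Z = 2 * h%:Z + 1 by rewrite hE; lia.
have cop4 : coprimez (q ^ 2)%N 4.
  by rewrite coprimezE -[`|4|%N]/(2 ^ 2)%N coprimeXl// coprimeXr// coprimen2.
split.
- rewrite Euclid_dvdzM// negb_or prime_ndvd_lucasV//; last by rewrite uE dvdz_mull.
  rewrite dvdzE /=; apply/negP => qh.
  have : (q %| 2 * h.+1 - q ^ 2)%N by rewrite dvdn_sub// ?dvdn_mull// dvdn_exp.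
  rewrite hE (_ : 2 * h.+1 - h.*2.+1 = 1)%N ?Euclid_dvd1//; lia.
- by apply/dvdzP; exists (- V m); rewrite hZ intS; ring.
(* After multiplication by 4, a unit modulo q^2, the claim compares 4 c^2, which is V_m^2 modulo
   q^2, with 4 (-b)^m; they differ by a multiple of U_m^2. *)
- rewrite -(Gauss_dvdzr _ cop4) mulrDr mulrN.
  have -> : 4 * (- b) ^+ m = V m ^+ 2 - (a ^+ 2 + 4 * b) * U m ^+ 2.
    by rewrite lucasV_norm; ring.
  apply/dvdzP; exists (V m ^+ 2 * ((q ^ 2)%N%:Z + 2) + (a ^+ 2 + 4 * b) * u ^+ 2).
  have -> : U m ^+ 2 = u ^+ 2 * (q ^ 2)%N%:Z by rewrite uE PoszM; ring.
  by rewrite hZ intS; ring.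
Qed.

End LucasCoprime.
(** [T] itself is a valid index, which excludes the default value 0, and the minimal index is a
    multiple of [T]. *)
Lemma tau_eq (a b k : int) (T : nat) : (0 < T)%N ->
  (forall t, (0 < t)%N -> (k %| lucasU a b t)%Z = (T %| t)%N) ->
  tau a b k = T.
Proof.
move=> T0 kE; rewrite /tau; case: pselect => [ex_t|[]]; last first.
  by exists T; rewrite T0 kE /=.
case: ex_minnP => t /andP[t0]; rewrite kE// => Tt min_t.
apply/eqP; rewrite eqn_leq (dvdn_leq t0 Tt) andbT.
by apply: min_t; rewrite T0 kE /=.
Qed.

(** * Positivity and growth, with recovery of an index from its term *)

Section LucasPositive.
Variables a b : int.
Hypothesis cop_ab : coprimez a b.
Hypothesis a_gt0 : 0 < a.
Hypothesis b_neq0 : b != 0.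
Hypothesis disc_gt0 : 0 < a ^+ 2 + 4 * b.
Local Notation U := (lucasU a b).
Local Notation V := (lucasV a b).

(** Since b may be negative, the induction runs on both sequences through 2 U_(n+1) = a U_n + V_n
    and 2 V_(n+1) = a V_n + Delta U_n, whose coefficients are positive. *)
Lemma lucas_ge0 n : 0 <= U n /\ 0 < V n.
Proof.
elim: n => [|n [u0 v0]]; first by [].
have uE : 2 * U n.+1 = a * U n + V n by rewrite lucasV_U; ring.
have vE : 2 * V n.+1 = a * V n + (a ^+ 2 + 4 * b) * U n.
  by rewrite !lucasV_U lucasUSS; ring.
have au : 0 <= a * U n by rewrite mulr_ge0// ltW.
have av : 0 < a * V n by rewrite mulr_gt0.
have du : 0 <= (a ^+ 2 + 4 * b) * U n by rewrite mulr_ge0// ltW.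
by split; lia.
Qed.

Lemma lucasV_gt0 n : 0 < V n.
Proof. by case: (lucas_ge0 n). Qed.

Lemma lucasU_gt0 n : (0 < n)%N -> 0 < U n.
Proof.
case: n => // n _; have [u0 v0] := lucas_ge0 n.
have uE : 2 * U n.+1 = a * U n + V n by rewrite lucasV_U; ring.
have au : 0 <= a * U n by rewrite mulr_ge0// ltW.
by lia.
Qed.

Lemma lucasU_neq0 n : (0 < n)%N -> U n != 0.
Proof. by move=> /lucasU_gt0; rewrite lt0r => /andP[]. Qed.

Lemma lucasV_neq0 n : V n != 0.
Proof. by have := lucasV_gt0 n; rewrite lt0r => /andP[]. Qed.

(** For a >= 2 this follows from 2 U_(n+1) = a U_n + V_n; for a = 1, Delta > 0 and b != 0 force b >=
    1. *)
Lemma lucasU_leS n : U n <= U n.+1.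
Proof.
have [u0 v0] := lucas_ge0 n.
have [a2|a2] := leP 2 a.
  have uE : 2 * U n.+1 = a * U n + V n by rewrite lucasV_U; ring.
  by have := ler_wpM2r u0 a2; lia.
have a1 : a = 1 by lia.
have b1 : 1 <= b by move: disc_gt0; rewrite a1 expr1n; lia.
case: n u0 v0 => // n _ _; have [u0 _] := lucas_ge0 n.
have bu : 0 <= b * U n by rewrite mulr_ge0//; lia.
by rewrite lucasUSS -{1}(mul1r (U n.+1)) -{1}a1 lerDl.
Qed.

(** Strictness starts at index 2 because U_2 = a may equal U_1 = 1. *)
Lemma lucasU_ltS n : (1 < n)%N -> U n < U n.+1.
Proof.
case: n => [|[|n]]// _; have u1 : 0 < U n.+2 by exact: lucasU_gt0.
have [u0 v0] := lucas_ge0 n.+2.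
have [a2|a2] := leP 2 a.
  have uE : 2 * U n.+3 = a * U n.+2 + V n.+2 by rewrite (lucasV_U _ _ n.+2); ring.
  by have := ler_wpM2r u0 a2; lia.
have a1 : a = 1 by lia.
have b1 : 1 <= b by move: disc_gt0; rewrite a1 expr1n; lia.
have u2 : 0 < U n.+1 by exact: lucasU_gt0.
have bu : 0 < b * U n.+1 by rewrite mulr_gt0//; lia.
by rewrite (lucasUSS a b n.+1) -{1}(mul1r (U n.+2)) -{1}a1 ltrDl.
Qed.

Lemma lucasU_le m n : (m <= n)%N -> U m <= U n.
Proof.
move=> /subnK <-; elim: (n - m)%N => [|k IHk]; first by rewrite add0n.
by rewrite addSn (le_trans IHk)// lucasU_leS.
Qed.

(** With g = gcd(m, t), U_m divides U_g; if g < m then U_g <= U_(m-1) < U_m, a contradiction. The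
    index 2 is excluded because U_2 = a may be 1. *)
Lemma dvdz_lucasU_index m t : (0 < m)%N -> (0 < t)%N -> m != 2%N ->
  (U m %| U t)%Z -> (m %| t)%N.
Proof.
move=> m0 t0 m2 mt; have := dvdz_lucasU_gcd cop_ab (dvdzz (U m)) mt.
have g0 : (0 < gcdn m t)%N by rewrite gcdn_gt0 m0.
have gm := dvdn_leq m0 (dvdn_gcdl m t).
move: gm; rewrite leq_eqVlt => /orP[/eqP <- _|gm]; first exact: dvdn_gcdr.
rewrite dvdzE => /dvdn_leq; rewrite absz_gt0 lucasU_neq0// => /(_ isT).
have := lucasU_gt0 m0; have := lucasU_gt0 g0.
have le_g : U (gcdn m t) <= U m.-1 by apply: lucasU_le; lia.
have : U m.-1 < U m by rewrite -[in ltRHS](prednK m0) lucasU_ltS//; lia.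
by lia.
Qed.

(** * Valuations along the multiples of an index *)

Lemma logn_lucasU_ndvd (q m k : nat) : prime q -> (0 < m)%N -> (q %| U m)%Z ->
  ~~ (q %| k)%N -> logn q `|U (m * k)| = logn q `|U m|.
Proof.
move=> q_pr m0 qm qk.
have k0 : (0 < k)%N by case: k qk => //; rewrite dvdn0.
have := @lucasU_neq0 (m * k); rewrite muln_gt0 m0 k0 => /(_ isT).
rewrite lucasU_mul mulf_eq0 negb_or => /andP[u0 w0].
by rewrite lognzM// [X in (_ + X)%N]lognz_ndvd ?addn0// lucasU_ratio_ndvd.
Qed.

(** The double root modulo q^2 makes U_(mq) / U_m congruent to q c^(q-1), with c prime to q, so the
    quotient has valuation exactly 1. *)
Lemma logn_lucasU_prime (q m : nat) : prime q -> (0 < m)%N ->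
  (q %| U m)%Z -> (q = 2%N -> (4 %| U m)%Z) ->
  logn q `|U (m * q)| = (logn q `|U m|).+1.
Proof.
move=> q_pr m0 qm q4; have q0 := prime_gt0 q_pr.
have := @lucasU_neq0 (m * q); rewrite muln_gt0 m0 q0 => /(_ isT).
rewrite lucasU_mul mulf_eq0 negb_or => /andP[u0 w0].
rewrite lognzM// -addn1; congr (_ + _)%N.
have [c [qc A B]] := double_root_mod_square cop_ab q_pr qm q4.
have := lucasU_mod_double_root q.-1 A B; rewrite prednK//.
move: w0; set W := lucasU _ _ _ => w0 Wc.
have c0 : c != 0 by apply: contraNneq qc => ->; rewrite dvdz0.
have logc : logn q `|(q : int) * c ^+ q.-1| = 1%N.
  rewrite lognzM ?expf_neq0//; last by lia.
  rewrite /= logn_prime// eqxx lognz_ndvd ?expf_neq0//.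
  by apply: contra qc; apply: Euclid_dvdzX.
have n0 : (q : int) * c ^+ q.-1 != 0 by rewrite mulf_neq0 ?expf_neq0//; lia.
(* The congruence is known modulo q^2 only; the exponents 1 and 2 suffice to fix the valuation. *)
have divW e : (e <= 2)%N -> (e <= logn q `|W|)%N = (e <= 1)%N.
  move=> e2; rewrite -logc -!pfactor_dvdn ?absz_gt0//.
  have Wce : ((q ^ e)%N %| W - (q : int) * c ^+ q.-1)%Z.
    by apply: dvdz_trans Wc; rewrite dvdzE /= dvdn_exp2l.
  rewrite -[(q ^ e %| `|W|)%N]/((q ^ e)%N %| W)%Z.
  rewrite -[(q ^ e %| `|_|)%N]/((q ^ e)%N %| (q : int) * c ^+ q.-1)%Z.
  by rewrite -[W in LHS](subrK ((q : int) * c ^+ q.-1)) rpredDl.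
by have := divW 1%N isT; have := divW 2%N isT; lia.
Qed.

(** Factors q of k are moved into the index one at a time, each adding 1; the remaining cofactor,
    prime to q, adds nothing. *)
Lemma logn_lucasU_mul (q m k : nat) : prime q -> (0 < m)%N -> (0 < k)%N ->
  (q %| U m)%Z -> (q = 2%N -> (4 %| U m)%Z) ->
  logn q `|U (m * k)| = (logn q `|U m| + logn q k)%N.
Proof.
move=> q_pr; elim/ltn_ind: k m => k IHk m m0 k0 qm q4.
have [/dvdnP[j jE]|qk] := boolP (q %| k)%N; last first.
  by rewrite logn_lucasU_ndvd// [logn q k]lognE (negPf qk) !andbF addn0.
move: k0; rewrite {}jE in IHk *; rewrite muln_gt0 => /andP[j0 q0].
have dvd_mq x : (x %| U m)%Z -> (x %| U (m * q))%Z.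
  by move=> /dvdz_trans; apply; apply: dvdz_lucasU_mul.
rewrite mulnCA [(j * _)%N]mulnC IHk//.
- by rewrite logn_lucasU_prime// lognM// [logn q q]logn_prime// eqxx; lia.
- by rewrite ltn_Pmulr// prime_gt1.
- by rewrite muln_gt0 m0.
- exact: dvd_mq.
- by move=> /q4/dvd_mq.
Qed.

Lemma logn_lucasU_double (q m : nat) : (0 < m)%N ->
  logn q `|U (2 * m)| = (logn q `|U m| + logn q `|V m|)%N.
Proof. by move=> m0; rewrite mul2n -addnn lucasU_double lognzM ?lucasU_neq0 ?lucasV_neq0. Qed.

(** Doubling the index supplies the condition required at q = 2, as U_m and V_m are both even. *)
Lemma dvd4_lucasU_double m : (2 %| U m)%Z -> (4 %| U (2 * m))%Z.
Proof.
move=> um; have vm := lucasU_even_V um; rewrite mul2n -addnn lucasU_double.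
by rewrite -[4]/(2 * 2 : int) dvdz_mul.
Qed.

Lemma logn_lucasU_eq0 (q m n : nat) : prime q -> (0 < m)%N -> (0 < n)%N ->
  ~~ (q %| U (gcdn m n))%Z -> logn q `|U m| = 0%N \/ logn q `|U n| = 0%N.
Proof.
move=> q_pr m0 n0 qg.
have [qm|] := boolP (q %| U m)%Z; last by left; apply: lognz_ndvd; rewrite ?lucasU_neq0.
have [qn|] := boolP (q %| U n)%Z; last by right; apply: lognz_ndvd; rewrite ?lucasU_neq0.
by rewrite dvdz_lucasU_gcd in qg.
Qed.

Lemma logn_lucasU_dvd (q m n : nat) : (0 < n)%N -> (m %| n)%N ->
  (logn q `|U m| <= logn q `|U n|)%N.
Proof.
move=> n0 mn; apply: dvdn_leq_log; first by rewrite absz_gt0 lucasU_neq0.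
by rewrite -[(_ %| _)%N]/(U m %| U n)%Z dvdz_lucasU.
Qed.

(** * Valuation of a product of three terms, for each parity pattern *)

Lemma logn_odd (m : nat) : odd m -> logn 2 m = 0%N.
Proof. by move=> m_odd; rewrite lognE dvdn2 m_odd !andbF. Qed.

(** The indices have pairwise gcd d. If q does not divide U_d, it divides at most one factor and
    both sides hold. Otherwise each factor contributes v_q(U_d), while the right-hand term contains
    it once, so s must supply it twice. *)
Lemma logn_lucasU_triple_odd (q d x y z s : nat) : prime q ->
  (0 < d)%N -> (0 < x)%N -> (0 < y)%N -> (0 < z)%N -> (0 < s)%N ->
  odd x -> odd z -> ~~ odd y -> coprime x y -> coprime x z -> coprime y z ->
  (logn q `|U (d * x)| + logn q `|U (d * y)| + logn q `|U (d * z)|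
     <= logn q `|U (d * x * y * z * s)|)%N
  = (2 * logn q `|U d| <= logn q s)%N.
Proof.
move=> q_pr d0 x0 y0 z0 s0 ox oz ey xy xz yz.
have [qd|qd] := boolP (q %| U d)%Z; last first.
  have gd m n : coprime m n -> gcdn (d * m) (d * n) = d.
    by rewrite -muln_gcdr => /eqP ->; rewrite muln1.
  have := @logn_lucasU_dvd q (d * x) (d * x * y * z * s).
  have := @logn_lucasU_dvd q (d * y) (d * x * y * z * s).
  have := @logn_lucasU_dvd q (d * z) (d * x * y * z * s).
  have := @logn_lucasU_eq0 q (d * x) (d * y).
  have := @logn_lucasU_eq0 q (d * x) (d * z).
  have := @logn_lucasU_eq0 q (d * y) (d * z).
  rewrite !gd// !muln_gt0 d0 x0 y0 z0 s0 => /(_ q_pr isT isT qd) yz0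
    /(_ q_pr isT isT qd) xz0 /(_ q_pr isT isT qd) xy0.
  have dx : (d * x %| d * x * y * z * s)%N 
    by apply/dvdnP; exists (y * z * s)%N; ring.
  have dy : (d * y %| d * x * y * z * s)%N.
    by apply/dvdnP; exists (x * z * s)%N; ring.
  have dz : (d * z %| d * x * y * z * s)%N.
    by apply/dvdnP; exists (x * y * s)%N; ring.
  move=> /(_ isT dz) lz /(_ isT dy) ly /(_ isT dx) lx.
  rewrite [logn q `|U d|]lognz_ndvd ?lucasU_neq0//.
  move: xy0 xz0 yz0 lx ly lz; clear; lia.
(* For q = 2, U_d may be only 2 modulo 4, so the computation starts from U_(dy), divisible by 4
   since y is even. *)
have [q2|q2] := eqVneq q 2%N.
  subst q; have hy : y = (2 * y./2)%N by rewrite mul2n even_halfK.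
  have -> : (d * x * y * z * s = d * y * (x * z * s))%N by ring.
  have qy : (2 %| U (d * y./2))%Z by apply: dvdz_trans qd (dvdz_lucasU_mul _ _ _ _).
  have q4 : (4 %| U (d * y))%Z.
    by rewrite hy mulnCA; apply: dvd4_lucasU_double.
  rewrite (@logn_lucasU_ndvd 2 d x)// ?dvdn2 ?ox// (@logn_lucasU_ndvd 2 d z)// ?dvdn2 ?oz//.
  rewrite (@logn_lucasU_mul 2 (d * y)) ?muln_gt0 ?d0 ?x0 ?y0 ?z0//; last exact: dvdz_trans q4.
  rewrite !lognM ?muln_gt0 ?x0 ?z0// (logn_odd ox) (logn_odd oz); clear; lia.
have q4 m : q = 2%N -> (4 %| U m)%Z by move/eqP; rewrite (negPf q2).
rewrite -!mulnA !(@logn_lucasU_mul q d) ?muln_gt0 ?x0 ?y0 ?z0//; try exact: q4.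
rewrite !lognM ?muln_gt0 ?y0 ?z0//; clear; lia.
Qed.

(** The outer indices have gcd 2 d, and U_(2d) = U_d V_d. Hence v_q(V_d) is counted twice among the
    factors and once on the right; the missing copy comes from s, except for what v_q(z) already
    provides. *)
Lemma logn_lucasU_triple_even (q d y z w s : nat) : prime q ->
  (0 < d)%N -> (0 < y)%N -> (0 < z)%N -> (0 < w)%N -> (0 < s)%N ->
  odd z -> odd (y + w) -> coprime y z -> coprime y w -> coprime z w ->
  (logn q `|U (2 * d * y)| + logn q `|U (d * z)| + logn q `|U (2 * d * w)|
     <= logn q `|U (2 * d * y * z * w * s)|)%N
  = (2 * logn q `|U d|
       + (logn q `|V d| - minn (logn q `|V d|) (logn q z)) <= logn q s)%N.
Proof.
move=> q_pr d0 y0 z0 w0 s0 oz oyw yz yw zw.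
have v2d := logn_lucasU_double q d0.
have q4 (m : nat) : q != 2%N -> q = 2%N -> (4 %| U m)%Z by case: eqP.
have U2d : (q %| U (2 * d))%Z = (q %| U d)%Z || (q %| V d)%Z.
  by rewrite mul2n -addnn lucasU_double Euclid_dvdzM.
have gz m : coprime m z -> gcdn (2 * d * m) (d * z) = d.
  move=> mz; rewrite [(2 * d)%N]mulnC -mulnA -muln_gcdr; apply/eqP.
  by rewrite -[eqbRHS]muln1 eqn_mul2l -[_ == 1]/(coprime _ _) coprimeMl mz
    coprime2n oz orbT.
have gyw : gcdn (2 * d * y) (2 * d * w) = (2 * d)%N.
  by rewrite -muln_gcdr (eqP yw) muln1.
have [qd|qd] := boolP (q %| U d)%Z.
  have [q2|q2] := eqVneq q 2%N.
    subst q; have vd := lucasU_even_V qd.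
    have D4 := dvd4_lucasU_double qd.
    have D2 : (2 %| U (2 * d))%Z by rewrite U2d qd.
    rewrite -[(2 * d * y * z * w * s)%N]mulnA -[(2 * d * y * z * _)%N]mulnA.
    rewrite -[(2 * d * y * _)%N]mulnA.
    rewrite !(@logn_lucasU_mul 2 (2 * d)) ?muln_gt0 ?d0 ?y0 ?z0 ?w0//.
    rewrite (@logn_lucasU_ndvd 2 d)// ?dvdn2 ?oz//.
    by rewrite !lognM ?muln_gt0 ?z0 ?w0// (logn_odd oz) v2d; clear; lia.
  have D : (q %| U (2 * d))%Z by rewrite U2d qd.
  have vV : logn q `|V d| = 0%N.
    by apply: lognz_ndvd; rewrite ?lucasV_neq0// prime_ndvd_lucasV.
  rewrite -[(2 * d * y * z * w * s)%N]mulnA -[(2 * d * y * z * _)%N]mulnA.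
  rewrite -[(2 * d * y * _)%N]mulnA.
  rewrite !(@logn_lucasU_mul q (2 * d)) ?muln_gt0 ?d0 ?y0 ?z0 ?w0//; try exact: q4.
  rewrite (@logn_lucasU_mul q d)//; try exact: q4.
  by rewrite !lognM ?muln_gt0 ?z0 ?w0// v2d vV; clear; lia.
have vd : logn q `|U d| = 0%N by apply: lognz_ndvd; rewrite ?lucasU_neq0.
have yL : (2 * d * y %| 2 * d * y * z * w * s)%N 
  by apply/dvdnP; exists (z * w * s)%N; ring.
have zL : (d * z %| 2 * d * y * z * w * s)%N.
  by apply/dvdnP; exists (2 * y * w * s)%N; ring.
have wL : (2 * d * w %| 2 * d * y * z * w * s)%N.
  by apply/dvdnP; exists (y * z * s)%N; ring.
have L0 : (0 < 2 * d * y * z * w * s)%N by rewrite !muln_gt0 d0 y0 z0 w0 s0.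
have d2 : (0 < 2 * d)%N by rewrite muln_gt0.
have dy0 : (0 < 2 * d * y)%N by rewrite muln_gt0 d2.
have dw0 : (0 < 2 * d * w)%N by rewrite muln_gt0 d2.
have dz0 : (0 < d * z)%N by rewrite muln_gt0 d0.
have [qV|qV] := boolP (q %| V d)%Z; last first.
  have D : ~~ (q %| U (2 * d))%Z by rewrite U2d negb_or qd.
  have vV : logn q `|V d| = 0%N by apply: lognz_ndvd; rewrite ?lucasV_neq0.
  have := logn_lucasU_dvd q L0 yL; have := logn_lucasU_dvd q L0 zL.
  have := logn_lucasU_dvd q L0 wL.
  have := @logn_lucasU_eq0 q _ _ q_pr dy0 dz0.
  have := @logn_lucasU_eq0 q _ _ q_pr dw0 dz0.
  have := @logn_lucasU_eq0 q _ _ q_pr dy0 dw0.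
  rewrite !gz// 1?coprime_sym// gyw => /(_ D) + /(_ qd) + /(_ qd).
  by rewrite vd vV; clear; lia.
have D : (q %| U (2 * d))%Z by rewrite U2d qV orbT.
(* A prime dividing U_(2d) and U_(dz) would divide U_d, because z is odd. *)
have vz : logn q `|U (d * z)| = 0%N.
  apply: lognz_ndvd; rewrite ?lucasU_neq0//; apply: contra qd => qz.
  by have := dvdz_lucasU_gcd cop_ab D qz; rewrite -[(2 * d)%N]muln1 gz// coprime1n.
have [q2|q2] := eqVneq q 2%N; last first.
  rewrite -[(2 * d * y * z * w * s)%N]mulnA -[(2 * d * y * z * _)%N]mulnA.
  rewrite -[(2 * d * y * _)%N]mulnA.
  rewrite !(@logn_lucasU_mul q (2 * d)) ?muln_gt0 ?d0 ?y0 ?z0 ?w0//; try exact: q4.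
  by rewrite !lognM ?muln_gt0 ?z0 ?w0// v2d vd vz; clear; lia.
subst q.
(* Here U_(2d) may be only 2 modulo 4. Exactly one of y and w is even; calling it i, the term
   U_(2di) is divisible by 4 and serves as the base. *)
have even_case i j : (0 < i)%N -> (0 < j)%N -> ~~ odd i -> odd j ->
  (logn 2 `|U (2 * d * i)| + logn 2 `|U (2 * d * j)|
     <= logn 2 `|U (2 * d * i * (z * j * s))|)%N = (logn 2 `|V d| <= logn 2 s)%N.
  move=> i0 j0 ei oj.
  have Di : (2 %| U (2 * d * i./2))%Z by apply: dvdz_trans D (dvdz_lucasU_mul _ _ _ _).
  have D4 : (4 %| U (2 * d * i))%Z.
    have -> : (2 * d * i = 2 * (2 * d * i./2))%N.
      have {1}-> : i = (2 * i./2)%N by rewrite mul2n even_halfK.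
      by ring.
    exact: dvd4_lucasU_double.
  rewrite (@logn_lucasU_ndvd 2 (2 * d) j)// ?dvdn2 ?oj//.
  rewrite (@logn_lucasU_mul 2 (2 * d * i)) ?muln_gt0 ?d0 ?i0 ?j0 ?z0//; last exact: dvdz_trans D4.
  by rewrite !lognM ?muln_gt0 ?z0 ?j0// (logn_odd oz) (logn_odd oj) v2d vd; clear; lia.
rewrite vz vd (logn_odd oz) minn0 subn0 !add0n addn0.
have [oy|ey] := boolP (odd y).
  rewrite addnC -(even_case w y)//; last by move: oyw; rewrite oddD oy; case: odd.
  by congr (_ <= logn _ `|U _|)%N; ring.
rewrite -(even_case y w)//; last by move: oyw; rewrite oddD (negPf ey).
by congr (_ <= logn _ `|U _|)%N; ring.
Qed.


(** * From valuations to the exact set of indices *)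

Lemma dvdz_lucasU3_lognP (m n r t : nat) :
  (0 < m)%N -> (0 < n)%N -> (0 < r)%N -> (0 < t)%N ->
  (forall q, prime q ->
    logn q `|U m| + logn q `|U n| + logn q `|U r| <= logn q `|U t|)%N <->
  (U m * U n * U r %| U t)%Z.
Proof.
move=> m0 n0 r0 t0; rewrite dvdzE -dvdn_logP ?absz_gt0 ?mulf_neq0 ?lucasU_neq0//.
by split=> H q /H; rewrite !lognzM ?mulf_neq0 ?lucasU_neq0.
Qed.

Lemma dvdn_coprime_triple (d x y z t : nat) : (0 < d)%N ->
  coprime x y -> coprime x z -> coprime y z ->
  (d * x %| t)%N -> (d * y %| t)%N -> (d * z %| t)%N -> (d * x * y * z %| t)%N.
Proof.
move=> d0 xy xz yz dx; have /dvdnP[u uE] := dvdn_trans (dvdn_mulr x (dvdnn d)) dx.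
move: dx; rewrite uE [(u * d)%N]mulnC -!mulnA !dvdn_pmul2l// => dx dy dz.
by rewrite mulnA !Gauss_dvd ?dx ?dy ?dz// coprimeMl xz.
Qed.

(** Each factor forces its index to divide t: d x and d z are odd and d y exceeds 2, so none is the
    exceptional index 2. Then t = d x y z s, and the valuations determine s. *)
Lemma dvdz_lucasU_triple_odd (d x y z t : nat) :
  (0 < d)%N -> (0 < x)%N -> (0 < y)%N -> (0 < z)%N -> (0 < t)%N ->
  odd d -> odd x -> odd z -> ~~ odd y -> (2 < d * y)%N ->
  coprime x y -> coprime x z -> coprime y z ->
  (U (d * x) * U (d * y) * U (d * z) %| U t)%Z
  = (d * x * y * z * `|U d| ^ 2 %| t)%N.
Proof.
move=> d0 x0 y0 z0 t0 od ox oz ey dy2 xy xz yz.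
have dx0 : (0 < d * x)%N by rewrite muln_gt0 d0.
have dy0 : (0 < d * y)%N by rewrite muln_gt0 d0.
have dz0 : (0 < d * z)%N by rewrite muln_gt0 d0.
have L0 : (0 < d * x * y * z)%N by rewrite !muln_gt0 d0 x0 y0.
have odd_neq2 m : odd m -> m != 2%N by apply: contraTneq => ->.
have u0 : (0 < `|U d| ^ 2)%N by rewrite expn_gt0 absz_gt0 lucasU_neq0.
suff main s : (0 < s)%N -> (U (d * x) * U (d * y) * U (d * z)
    %| U (d * x * y * z * s))%Z = (`|U d| ^ 2 %| s)%N.
  apply/idP/idP => [ut|/dvdnP[s tE]].
    have Lt : (d * x * y * z %| t)%N.
      apply: dvdn_coprime_triple => //; apply: dvdz_lucasU_index => //.
      - by apply: odd_neq2; rewrite oddM od.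
      - by apply: dvdz_trans ut; rewrite -mulrA dvdz_mulr.
      - by rewrite gtn_eqF.
      - by apply: dvdz_trans ut; rewrite dvdz_mulr// dvdz_mull.
      - by apply: odd_neq2; rewrite oddM od.
      - by apply: dvdz_trans ut; rewrite dvdz_mull.
    case/dvdnP: Lt ut t0 => s ->; rewrite mulnC muln_gt0 L0 /= => ut s0.
    by rewrite dvdn_pmul2l// -main.
  have s0 : (0 < s)%N by move: t0; rewrite tE muln_gt0 => /andP[].
  have -> : t = (d * x * y * z * (s * `|U d| ^ 2))%N by rewrite tE; ring.
  by rewrite main; [exact: dvdn_mull | rewrite muln_gt0 s0].
move=> s0; have Ls0 : (0 < d * x * y * z * s)%N by rewrite muln_gt0 L0.
apply/idP/idP => H.
- apply/dvdn_logP => // q q_pr; rewrite lognX -(@logn_lucasU_triple_odd q d x y z)//.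
  by have /dvdz_lucasU3_lognP := H; apply.
- apply/dvdz_lucasU3_lognP => // q q_pr.
  by rewrite logn_lucasU_triple_odd// -lognX dvdn_leq_log.
Qed.

Lemma dvdz_lucasU_triple_even (d y z w t : nat) :
  (0 < d)%N -> (0 < y)%N -> (0 < z)%N -> (0 < w)%N -> (0 < t)%N ->
  odd d -> odd z -> odd (y + w) -> coprime y z -> coprime y w -> coprime z w ->
  (U (2 * d * y) * U (d * z) * U (2 * d * w) %| U t)%Z
  = (2 * d * y * z * w * (`|U d| ^ 2 * (`|V d| %/ gcdn `|V d| z)) %| t)%N.
Proof.
move=> d0 y0 z0 w0 t0 od oz oyw yz yw zw; set R := (_ ^ 2 * _)%N.
have d2 : (0 < 2 * d)%N by rewrite muln_gt0.
have dy0 : (0 < 2 * d * y)%N by rewrite muln_gt0 d2.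
have dw0 : (0 < 2 * d * w)%N by rewrite muln_gt0 d2.
have dz0 : (0 < d * z)%N by rewrite muln_gt0 d0.
have L0 : (0 < 2 * d * y * z * w)%N by rewrite !muln_gt0 d0 y0 z0.
have u0 : (0 < `|U d| ^ 2)%N by rewrite expn_gt0 absz_gt0 lucasU_neq0.
have v0 : (0 < `|V d|)%N by rewrite absz_gt0 lucasV_neq0.
have g0 : (0 < gcdn `|V d| z)%N by rewrite gcdn_gt0 v0.
have vg0 : (0 < `|V d| %/ gcdn `|V d| z)%N.
  by rewrite divn_gt0// dvdn_leq// dvdn_gcdl.
have R0 : (0 < R)%N by rewrite muln_gt0 u0.
have logR q : logn q R = (2 * logn q `|U d|
    + (logn q `|V d| - minn (logn q `|V d|) (logn q z)))%N.
  by rewrite lognM// lognX logn_div ?dvdn_gcdl// logn_gcd.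
have index m : (0 < m)%N -> m != 2%N -> (U m %| U t)%Z -> (m %| t)%N.
  by move=> m0; apply: dvdz_lucasU_index.
suff main s : (0 < s)%N -> (U (2 * d * y) * U (d * z) * U (2 * d * w)
    %| U (2 * d * y * z * w * s))%Z = (R %| s)%N.
  apply/idP/idP => [ut|/dvdnP[s tE]].
    have Lt : (2 * d * y * z * w %| t)%N.
      have ty : (U (2 * d * y) %| U t)%Z.
        by apply: dvdz_trans ut; rewrite -mulrA dvdz_mulr.
      have tw : (U (2 * d * w) %| U t)%Z by apply: dvdz_trans ut; rewrite dvdz_mull.
      have tz : (d * z %| t)%N.
        apply: index => //; last by apply: dvdz_trans ut; rewrite dvdz_mulr// dvdz_mull.
        by apply: contraTneq od => dz; have := congr1 odd dz; rewrite oddM oz andbT => ->.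
      (* One of the outer indices may equal 2. The one with an even cofactor is at least 4, so it
         divides t and makes t even, which settles the exceptional index. *)
      have t2 : (2 %| t)%N.
        have ev i : (U (2 * d * i) %| U t)%Z -> (0 < i)%N -> ~~ odd i -> (2 %| t)%N.
          move=> ti i0 ei; have /index : (0 < 2 * d * i)%N by rewrite muln_gt0 d2.
          move=> /(_ _ ti) it; apply: dvdn_trans (it _); first by rewrite -mulnA dvdn_mulr.
          apply: contraNneq ei => /eqP; rewrite -mulnA -[eqbRHS]muln1 eqn_pmul2l// => /eqP di.
          by have := congr1 odd di; rewrite oddM => /andP[].
        have [oy|ey] := boolP (odd y); last exact: ev ty y0 ey.
        by apply: ev tw w0 _; move: oyw; rewrite oddD oy.
      have idx i : (0 < i)%N -> (U (2 * d * i) %| U t)%Z -> (2 * d * i %| t)%N.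
        move=> i0 ti; have [->//|] := eqVneq (2 * d * i)%N 2%N.
        by move/index; apply=> //; rewrite muln_gt0 d2.
      have dyt := idx _ y0 ty; have dwt := idx _ w0 tw.
      apply: dvdn_coprime_triple => //.
      (* The divisor d z is upgraded to 2 d z, using that 2 d divides t and z is odd. *)
      have /dvdnP[r rE] : (2 * d %| t)%N by apply: dvdn_trans dwt; rewrite dvdn_mulr.
      have rE' : t = (d * (2 * r))%N by rewrite rE; ring.
      move: tz; rewrite rE' dvdn_pmul2l// Gauss_dvdr ?coprimen2// => zr.
      by rewrite mulnCA mulnA dvdn_pmul2l.
    case/dvdnP: Lt ut t0 => s ->; rewrite mulnC muln_gt0 L0 /= => ut s0.
    by rewrite dvdn_pmul2l// -main.
  have s0 : (0 < s)%N by move: t0; rewrite tE muln_gt0 => /andP[].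
  have -> : t = (2 * d * y * z * w * (s * R))%N by rewrite tE; ring.
  by rewrite main; [exact: dvdn_mull | rewrite muln_gt0 s0].
move=> s0; have Ls0 : (0 < 2 * d * y * z * w * s)%N by rewrite muln_gt0 L0.
apply/idP/idP => H.
- apply/dvdn_logP => // q q_pr; rewrite logR -(@logn_lucasU_triple_even q d y z w)//.
  by have /dvdz_lucasU3_lognP := H; apply.
- apply/dvdz_lucasU3_lognP => // q q_pr.
  by rewrite logn_lucasU_triple_even// -logR dvdn_leq_log.
Qed.

(** * Order of appearance for the indices d x, d (x + e), d (x + 2 e) *)

Lemma tau_progression_odd (d e x : nat) : odd d -> odd e -> odd x ->
  (2 < d * (x + e))%N -> coprime x e ->
  tau a b (U (d * x)%N * U (d * (x + e))%N * U (d * (x + 2 * e))%N)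
  = (d * x * (x + e) * (x + 2 * e) * `|U d| ^ 2)%N.
Proof.
move=> od oe ox dxe xe.
have d0 := odd_gt0 od; have x0 := odd_gt0 ox.
have xe0 : (0 < x + e)%N by rewrite addn_gt0 x0.
have xe20 : (0 < x + 2 * e)%N by rewrite addn_gt0 x0.
apply: tau_eq => [|t t0].
  by rewrite !muln_gt0 d0 x0 xe0 xe20 /= absz_gt0 lucasU_neq0.
apply: dvdz_lucasU_triple_odd => //.
- by rewrite oddD ox mul2n odd_double.
- by rewrite oddD ox oe.
- by rewrite /coprime gcdnDl.
- by rewrite /coprime gcdnDl -/(coprime _ _) coprimeMr coprimen2 ox.
- by rewrite mul2n -addnn addnA /coprime gcdnDl gcdnC gcdnDr gcdnC.
Qed.

(** The progression with x = 2 y: the outer indices acquire the factor 2, the middle one stays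
    odd. *)
Lemma tau_progression_even (d e y : nat) : odd d -> odd e -> (0 < y)%N ->
  coprime y e ->
  tau a b (U (2 * d * y)%N * U (d * (2 * y + e))%N * U (2 * d * (y + e))%N)
  = (2 * d * y * (2 * y + e) * (y + e)
      * (`|U d| ^ 2 * (`|V d| %/ gcdn `|V d| (2 * y + e))))%N.
Proof.
move=> od oe y0 ye.
have d0 := odd_gt0 od.
have z0 : (0 < 2 * y + e)%N by rewrite addn_gt0 muln_gt0 y0.
have w0 : (0 < y + e)%N by rewrite addn_gt0 y0.
have v0 : (0 < `|V d|)%N by rewrite absz_gt0 lucasV_neq0.
apply: tau_eq => [|t t0].
  rewrite !muln_gt0 d0 y0 z0 w0 /= absz_gt0 lucasU_neq0//.
  by rewrite divn_gt0 ?gcdn_gt0 ?v0// dvdn_leq// dvdn_gcdl.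
apply: dvdz_lucasU_triple_even => //.
- by rewrite oddD mul2n odd_double.
- by rewrite addnA addnn oddD odd_double.
- by rewrite mul2n -addnn -addnA /coprime !gcdnDl.
- by rewrite /coprime gcdnDl.
- by rewrite mul2n -addnn -addnA coprime_sym /coprime gcdnDr gcdnC gcdnDl.
Qed.

End LucasPositive.

(** * The four cases of the formula *)

Theorem theorem1p2 (a b : int) (n p : nat) :
  coprimez a b ->
  lucas_nondegenerate a b ->
  0 < a ->
  0 < a ^+ 2 + 4 * b ->
  (0 < n)%N ->
  prime p ->
  (3 <= p)%N ->
  let U := lucasU a b in
  let V := lucasV a b in
  let N : rat := (n * (n + p) * (n + 2 * p))%:R in
  let t : rat := (tau a b (U n * U (n + p)%N * U (n + 2 * p)%N))%:R in
  [/\ (~~ (p %| n)%N -> ~~ (2 %| n)%N -> t = N),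
      (~~ (p %| n)%N -> (2 %| n)%N ->
         t = N / 2 * (a%:~R / (gcdz a (n + p)%N)%:~R)),
      ((p %| n)%N -> ~~ (2 %| n)%N ->
         t = N / p%:R ^+ 2 * (U p)%:~R ^+ 2) &
      ((p %| n)%N -> (2 %| n)%N ->
         t = N / (2 * p%:R ^+ 2) *
             ((U p)%:~R ^+ 2 * (V p)%:~R
                / (gcdz (V p) ((n + p) %/ p)%N)%:~R))].
Proof.
move=> cop [b0 _] a0 disc n0 p_pr p3 U V N t.
have p_odd : odd p by case: (even_prime p_pr) p3 => [->|].
have p0 := prime_gt0 p_pr; have pQ : p%:R != 0 :> rat by rewrite pnatr_eq0 -lt0n.
have absR (x : int) : 0 <= x -> x%:~R = `|x|%N%:R :> rat.
  by move=> x0; rewrite -[in LHS](gez0_abs x0).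
have UR : (U p)%:~R = `|U p|%N%:R :> rat by rewrite absR// ltW// lucasU_gt0.
(* The natural-number quotient is exact, so it agrees with the rational one. *)
have ratioR (x : int) (m : nat) : 0 < x ->
    (`|x| %/ gcdn `|x| m)%:R = x%:~R / (gcdz x m)%:~R :> rat.
  by move=> x0; rewrite (absR x (ltW x0)) natf_div ?dvdn_gcdl.
have evenE m : (2 %| m)%N -> exists2 y, m = (2 * y)%N & (0 < m)%N -> (0 < y)%N.
  by case/dvdnP=> y ->; exists y; rewrite 1?mulnC// muln_gt0 => /andP[].
split=> [pn|pn|/dvdnP[x nE]|/dvdnP[x nE]].
- rewrite dvdn2 negbK => n_odd; rewrite /t /N.
  have := @tau_progression_odd a b cop a0 b0 disc 1 p n isT p_odd n_odd.
  rewrite !mul1n => -> //; last first.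
  + by rewrite coprime_sym prime_coprime.
  + by rewrite (leq_trans p3)// leq_addl.
  by rewrite /= muln1.
(* Case d = 1, e = p, n = 2 y; here U_1 = 1 and V_1 = a. *)
- case/evenE=> y nE /(_ n0) y0.
  have := @tau_progression_even a b cop a0 b0 disc 1 p y isT p_odd y0.
  rewrite !mul1n muln1 mulnDr -nE /t /N => -> /=.
    rewrite ?mul1n !natrM ratioR//. have -> : (n + 2 * p = 2 * (y + p))%N by rewrite nE mulnDr.
    by set G := (a%:~R / _); rewrite natrM; field.
  rewrite coprime_sym prime_coprime//; apply: contra pn => py.
  by rewrite nE dvdn_mull.
- rewrite dvdn2 negbK => n_odd; rewrite /t /N.
  have x_odd : odd x by move: n_odd; rewrite nE oddM => /andP[].
  have := @tau_progression_odd a b cop a0 b0 disc p 1 x p_odd isT x_odd.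
  have E1 : (p * x = n)%N by rewrite nE mulnC.
  have E2 : (p * (x + 1) = n + p)%N by rewrite nE; ring.
  have E3 : (p * (x + 2 * 1) = n + 2 * p)%N by rewrite nE; ring.
  rewrite coprimen1 E1 E2 E3 => -> //; last by rewrite (leq_trans p3)// leq_addl.
  by rewrite UR natrM natrX nE !natrM !natrD !natrM; field.
(* Case d = p, e = 1, n = 2 p y; the middle cofactor 2 y + 1 is (n + p) / p. *)
- case/evenE=> m nE' _.
  have x_even : (2 %| x)%N.
    by move: p_odd (congr1 odd nE'); rewrite nE dvdn2 !oddM andbC => -> /= ->.
  have [y xE _] := evenE _ x_even.
  have y0 : (0 < y)%N by case: y xE => // xE; move: n0; rewrite nE xE.
  have := @tau_progression_even a b cop a0 b0 disc p 1 y p_odd isT y0.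
  have E1 : (2 * p * y = n)%N by rewrite nE xE; ring.
  have E2 : (p * (2 * y + 1) = n + p)%N by rewrite nE xE; ring.
  have E3 : (2 * p * (y + 1) = n + 2 * p)%N by rewrite nE xE; ring.
  have E4 : (2 * y + 1 = (n + p) %/ p)%N by rewrite -E2 mulKn.
  rewrite coprimen1 E1 E2 E3 /t => -> //.
  rewrite [in gcdn _ _]E4 natrM [(_ * (_ %/ _))%:R]natrM natrX ratioR ?lucasV_gt0// UR.
  set G := (gcdz _ _)%:~R^-1.
  by rewrite /N nE xE !natrM !natrD !natrM; field.
Qed.
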